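(* Let $A$ be an arbitrary index set and let $X=\prod_{\alpha\in A}X_\alpha$ be the Tychonoff product of topological spaces $X_\alpha$. Assume that $G_\alpha$ is a homeomorphism group of $X_\alpha$ for each $\alpha\in A$. Then the direct product of groups $G=\prod_{\alpha\in A}G_\alpha$ has a dense orbit in $X$ if and only if the group $G_\alpha$ has a dense orbit in $X_\alpha$ for every $\alpha\in A$.
   Context: A homeomorphism group of $X$ is a group of homeomorphisms of $X$ onto itself (no topology on the group is assumed). Every space on which a group acts is assumed to be infinite. The group $G=\prod_\alpha G_\alpha$ (with componentwise multiplication) acts on $X=\prod_\alpha X_\alpha$ canonically, i.e. $\{g_\alpha\}.\{x_\alpha\}=\{g_\alpha.x_\alpha\}$; the Tychonoff product carries the product topology. The orbit of $x$ is $G.x=\{g.x : g\in G\}$. *)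

(* Defs.v *)
From HB Require Import structures.
From mathcomp Require Import all_boot.
From mathcomp Require Import all_classical topology.

Set Implicit Arguments.
Unset Strict Implicit.
Unset Printing Implicit Defensive.

Local Open Scope classical_set_scope.

Definition homeomorphism (T U : topologicalType) (f : T -> U) : Prop :=
  continuous f /\
  exists g : U -> T, [/\ continuous g, cancel f g & cancel g f].

Record homeo_group (T : topologicalType) := HomeoGroup {
  hg_set : set (T -> T);
  hg_homeo : forall f, hg_set f -> homeomorphism f;
  hg_id : hg_set idfun;
  hg_comp : forall f g, hg_set f -> hg_set g -> hg_set (f \o g);
  hg_inv : forall f g, hg_set f -> cancel f g -> cancel g f -> hg_set g
}.

Definition hg_sort (T : topologicalType) (G : homeo_group T) : Type :=
  {f : T -> T | f \in hg_set G}.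
Coercion hg_sort : homeo_group >-> Sortclass.

Section HomeoGroupLaw.
Variables (T : topologicalType) (G : homeo_group T).
Implicit Types f g h : G.

HB.instance Definition _ := Choice.on (hg_sort G).

Definition hg_fun f : T -> T := val f.

Lemma hg_funP f : hg_set G (hg_fun f).
Proof. exact: set_mem (valP f). Qed.

Definition hg_mk (u : T -> T) (Gu : hg_set G u) : G :=
  exist (fun v => v \in hg_set G) u (mem_set Gu).

Definition hg_one : G := hg_mk (hg_id G).

Definition hg_mul f g : G := hg_mk (hg_comp (hg_funP f) (hg_funP g)).

Lemma hg_inv_ex f :
  exists g, cancel (hg_fun f) (hg_fun g) /\ cancel (hg_fun g) (hg_fun f).
Proof.
have [_ [u [_ fK uK]]] := hg_homeo (hg_funP f).
by exists (hg_mk (hg_inv (hg_funP f) fK uK)).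
Qed.

Definition hg_invg f : G := proj1_sig (cid (hg_inv_ex f)).

Lemma hg_invgP f : cancel (hg_fun f) (hg_fun (hg_invg f)) /\
                   cancel (hg_fun (hg_invg f)) (hg_fun f).
Proof. exact: proj2_sig (cid (hg_inv_ex f)). Qed.

Lemma hg_mulA : associative hg_mul.
Proof. by move=> f g h; apply: val_inj. Qed.

Lemma hg_mul1 : left_id hg_one hg_mul.
Proof. by move=> f; apply: val_inj. Qed.

Lemma hg_mulr1 : right_id hg_one hg_mul.
Proof. by move=> f; apply: val_inj. Qed.

Lemma hg_mulV : left_inverse hg_one hg_invg hg_mul.
Proof.
move=> f; apply: val_inj; apply/funext => x /=.
by have [fK _] := hg_invgP f; rewrite fK.
Qed.

Lemma hg_mulrV : right_inverse hg_one hg_invg hg_mul.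
Proof.
move=> f; apply: val_inj; apply/funext => x /=.
by have [_ fK] := hg_invgP f; rewrite fK.
Qed.

HB.instance Definition _ := isGroup.Build (hg_sort G)
  hg_mulA hg_mul1 hg_mulr1 hg_mulV hg_mulrV.

End HomeoGroupLaw.

Definition prod_group (A : Type) (G : A -> groupType) : Type :=
  forall a, G a.

Section ProdGroup.
Variables (A : Type) (G : A -> groupType).
Implicit Types g h k : prod_group G.

HB.instance Definition _ := gen_eqMixin (prod_group G).
HB.instance Definition _ := gen_choiceMixin (prod_group G).

Definition prod_one : prod_group G := fun a => 1%g.
Definition prod_inv g : prod_group G := fun a => (g a)^-1%g.
Definition prod_mul g h : prod_group G := fun a => (g a * h a)%g.

Lemma prod_mulA : associative prod_mul.
Proof. by move=> g h k; apply/functional_extensionality_dep => a; apply: mulgA. Qed.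

Lemma prod_mul1 : left_id prod_one prod_mul.
Proof. by move=> g; apply/functional_extensionality_dep => a; apply: mul1g. Qed.

Lemma prod_mulr1 : right_id prod_one prod_mul.
Proof. by move=> g; apply/functional_extensionality_dep => a; apply: mulg1. Qed.

Lemma prod_mulV : left_inverse prod_one prod_inv prod_mul.
Proof. by move=> g; apply/functional_extensionality_dep => a; apply: mulVg. Qed.

Lemma prod_mulrV : right_inverse prod_one prod_inv prod_mul.
Proof. by move=> g; apply/functional_extensionality_dep => a; apply: mulgV. Qed.

HB.instance Definition _ := isGroup.Build (prod_group G)
  prod_mulA prod_mul1 prod_mulr1 prod_mulV prod_mulrV.

End ProdGroup.

(* Actions of an arbitrary, possibly infinite group; [fingroup.action] only
   covers finite groups, and acts on the right. *)
Record group_action (G : groupType) (T : Type) := GroupAction {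
  gact :> G -> T -> T;
  gact1 : forall x, gact 1%g x = x;
  gactM : forall g h x, gact (g * h)%g x = gact g (gact h x)
}.

Definition orbit_of (G : groupType) (T : Type) (to : group_action G T) (x : T)
  : set T := [set to g x | g in [set: G]].

Definition has_dense_orbit (G : groupType) (T : topologicalType)
    (to : group_action G T) : Prop :=
  exists x : T, dense (orbit_of to x).

Definition hg_action (T : topologicalType) (G : homeo_group T)
  : group_action G T :=
  @GroupAction G T (@hg_fun T G) (fun=> erefl) (fun _ _ _ => erefl).

Section ProdAction.
Variables (A : Type) (G : A -> groupType) (X : A -> Type).
Variable to : forall a, group_action (G a) (X a).

Definition prod_act (g : prod_group G) (x : prod_topology X)
  : prod_topology X := fun a => to a (g a) (x a).

Lemma prod_act1 x : prod_act 1%g x = x.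
Proof. by apply/functional_extensionality_dep => a; apply: gact1. Qed.

Lemma prod_actM g h x : prod_act (g * h)%g x = prod_act g (prod_act h x).
Proof. by apply/functional_extensionality_dep => a; apply: gactM. Qed.

Definition prod_action : group_action (prod_group G) (prod_topology X) :=
  GroupAction prod_act1 prod_actM.

End ProdAction.

(* Main.v *)
(** A box [\prod_a U_a] with each [U_a] open meets a product orbit as soon as
    every [U_a] meets the corresponding factor orbit: choose the group elements
    coordinatewise. As every open set of the Tychonoff product contains such a
    box around each of its points, a product of dense orbits is dense.
    Conversely, each projection is a continuous surjection mapping the orbit of
    [x] onto the orbit of [x a]. *)
Require Import Defs.
From mathcomp Require Import all_boot.
From mathcomp Require Import all_classical topology.

Local Open Scope classical_set_scope.

Lemma choice_dep {I : Type} {T : I -> Type} {P : forall i, T i -> Prop} :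
  (forall i, exists t, P i t) -> exists f : forall i, T i, forall i, P i (f i).
Proof.
move=> exP; exists (fun i => proj1_sig (cid (exP i))) => i.
exact: proj2_sig (cid (exP i)).
Qed.

Lemma dense_image {T U : topologicalType} {f : T -> U} {S : set T} :
  continuous f -> range f = setT -> dense S -> dense (f @` S).
Proof.
move=> fc fsurj dS O [y Oy] oO.
have [x _ fxy] : range f y by rewrite fsurj.
have fO0 : f @^-1` O !=set0 by exists x; rewrite /preimage /= fxy.
have ofO : open (f @^-1` O) by move/continuousP: fc; apply.
have [z [Oz Sz]] := dS _ fO0 ofO.
by exists (f z); split => //; exists z.
Qed.

Section ProductSpace.
Context {A : Type} {X : A -> topologicalType}.

(* [{classic A}] provides the decidable equality on indices that the library
   needs to modify a point at one coordinate. *)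
Lemma prod_topology_proj_continuous (a : A) :
  continuous (fun x : prod_topology X => x a).
Proof. exact: (@proj_continuous {classic A} X a). Qed.

Lemma prod_topology_proj_surj (x : prod_topology X) (a : A) :
  range (fun y : prod_topology X => y a) = setT.
Proof.
apply/seteqP; split => // u _.
exists (@dfwith {classic A} X x a u) => //.
exact: (@dfwithin {classic A} X x a u).
Qed.

(** Every factor may be a proper open subset, so this is the fact that the box topology refines the
    product topology. *)
Lemma open_contains_box (O : set (prod_topology X)) (y : prod_topology X) :
  open O -> O y ->
  exists2 U : forall a, set (X a), (forall a, open_nbhs (y a) (U a)) &
    [set z : prod_topology X | forall a, U a (z a)] `<=` O.
Proof.
move=> oO Oy.
(* The boxes around [y] form a filter base; its filter converges to [y]
   because it does so in each coordinate. *)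
pose boxes : set (forall a, set (X a)) :=
  [set U | forall a, open_nbhs (y a) (U a)].
pose box (U : forall a, set (X a)) : set (prod_topology X) :=
  [set z | forall a, U a (z a)].
pose F := filter_from boxes box.
have FF : Filter F.
  apply: filter_from_filter.
    by exists (fun=> setT) => a; split => //; exact: openT.
  move=> U V nU nV; exists (fun a => U a `&` V a).
    by move=> a; exact: open_nbhsI.
  by move=> z UVz; split => a; have [] := UVz a.
have Fy : F --> y.
  apply/cvg_sup => a B [_ [[W oW <-] Wy] WB].
  (* Constrain only coordinate [a], by [W]; every other factor is the whole space. *)
  exists (@dfwith {classic A} (fun b => set (X b)) (fun=> setT) a W).
    move=> b; case: (@dfwithP {classic A} (fun b => set (X b))) => //= c _.
    by split => //; exact: openT.
  move=> z /(_ a) /=; rewrite (@dfwithin {classic A} (fun b => set (X b))).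
  exact: WB.
exact: (Fy O (open_nbhs_nbhs (conj oO Oy))).
Qed.

Lemma dense_box (S : forall a, set (X a)) : (forall a, dense (S a)) ->
  dense [set z : prod_topology X | forall a, S a (z a)].
Proof.
move=> dS O [y Oy] oO.
have [U nU UO] := open_contains_box _ _ oO Oy.
have US a : U a `&` S a !=set0.
  by have [oU Uy] := nU a; apply: dS => //; exists (y a).
have [z Uz] := choice_dep US.
by exists z; split => [|a]; [apply: UO => a|]; have [] := Uz a.
Qed.

End ProductSpace.

(** Elements of the full direct product are arbitrary families, so each coordinate of [z] can be
    reached independently, by choice. *)
Lemma orbit_prod_action (A : Type) (G : A -> groupType) (X : A -> Type)
    (to : forall a, group_action (G a) (X a)) (x : prod_topology X) :
  orbit_of (prod_action to) x =
    [set z | forall a, orbit_of (to a) (x a) (z a)].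
Proof.
apply/seteqP; split => [_ [g _ <-] a|z orbz]; first by exists (g a).
have gP a : exists g, to a g (x a) = z a by have [g _ <-] := orbz a; exists g.
have [g gE] := choice_dep gP.
by exists g => //; apply/functional_extensionality_dep.
Qed.

Lemma proj_orbit_prod_action (A : Type) (G : A -> groupType) (X : A -> Type)
    (to : forall a, group_action (G a) (X a)) (x : prod_topology X) (a : A) :
  (fun y => y a) @` orbit_of (prod_action to) x = orbit_of (to a) (x a).
Proof.
apply/seteqP; split => [_ [_ [g _ <-] <-]|_ [h _ <-]]; first by exists (g a).
(* Extend [h] by the identity in all other factors. *)
pose g : prod_group G := @dfwith {classic A} G (fun=> 1%g) a h.
exists (prod_action to g x); first by exists g.
by rewrite /= /prod_act /g (@dfwithin {classic A} G).
Qed.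

Theorem theorem3p3 (A : Type) (X : A -> topologicalType)
    (X_infinite : forall a : A, infinite_set [set: X a])
    (G : forall a : A, homeo_group (X a)) :
  has_dense_orbit (prod_action (fun a : A => hg_action (G a))) <->
  (forall a : A, has_dense_orbit (hg_action (G a))).
Proof.
split=> [[x dx] a|dG].
  exists (x a); rewrite -(proj_orbit_prod_action _ _ _ (fun b => hg_action (G b))).
  apply: dense_image dx; last exact: prod_topology_proj_surj.
  exact: prod_topology_proj_continuous.
(* Choice assembles base points of dense factor orbits into one point of the product. *)
have [x dx] := choice_dep dG.
by exists x; rewrite orbit_prod_action; exact: (dense_box _ dx).
Qed.
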